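(* Let $M=(E,\mathcal{C})$ be an oriented matroid of rank $r\ge 1$ with set of topes $\mathcal{T}(\mathcal{C})$. Then $$\mathcal{N}_M(1,T) = \sum_{\tau\in\mathcal{T}(\mathcal{C})} h(\Sigma(\tau);T).$$
   Context: An oriented matroid $M=(E,\mathcal{C})$ is given by a finite ground set $E$ and a set of covectors $\mathcal{C}\subseteq\{+,-,0\}^E$ (usual covector axioms). Covectors are partially ordered by $X\le Y$ iff $X_e\in\{0,Y_e\}$ for all $e\in E$, with bottom $\hat 0_{\mathcal{C}}=(0,\dots,0)$; the face lattice $\mathcal{F}(\mathcal{C})$ is $\mathcal{C}$ with an added top element $\hat 1_{\mathcal{C}}$. Topes are the maximal elements of $\mathcal{C}$; $\mathcal{T}(\mathcal{C})$ is the set of topes. The underlying matroid is the matroid on $E$ whose flats are the zero sets $\{e: X_e=0\}$, $X\in\mathcal{C}$; its lattice of flats is denoted $\mathcal{L}(M)$, and the rank of $M$ is the rank $r(M)$ of this matroid. For a tope $\tau$, $\Sigma(\tau)$ is the simplicial complex of all flags (chains, including the empty one) in the open interval $(\hat 0_{\mathcal{C}},\tau)$ of $\mathcal{F}(\mathcal{C})$. Its dimension is $r-2$; its $h$-polynomial is $h(\Sigma(\tau);T)=(1-T)^{r-1}f(\Sigma(\tau);T/(1-T))$, where $f(\Sigma(\tau);T)=\sum_{k=0}^{r-1}f_kT^k$ and $f_k$ is the number of flags with $k$ elements. For a matroid $M$ with lattice of flats $\mathcal{L}(M)$ (bottom $\hat 0$, top $\hat 1$, rank function $r$), the Möbius function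 is $\mu_M(\hat 0)=1$, $\mu_M(X)=-\sum_{X'<X}\mu_M(X')$, and the Poincaré polynomial is $\pi_M(Y)=\sum_{X\in\mathcal{L}(M)}\mu_M(X)(-Y)^{r(X)}$. For flats $X\subseteq X'$, the lattice of flats of the minor $M/X|X'$ is isomorphic to the interval $[X,X']$. Put $\overline{\mathcal{L}}(M)=\mathcal{L}(M)\setminus\{\hat 0,\hat 1\}$, and let $\Delta(\overline{\mathcal{L}}(M))$ be the set of all flags (finite chains, including the empty one) in it. For a flag $F=(X_1<\cdots<X_\ell)$ with $X_0=\hat 0$, $X_{\ell+1}=\hat 1$, set $|F|=\ell$ and $\pi_F(Y)=\prod_{k=0}^{\ell}\pi_{M/X_k|X_{k+1}}(Y)$. The coarse flag polynomial is $$\mathcal{N}_M(Y,T)=\sum_{F\in\Delta(\overline{\mathcal{L}}(M))}\pi_F(Y)\,T^{|F|}(1-T)^{r(M)-1-|F|}.$$ *)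

(* Defs.v *)
From HB Require Import structures.
From mathcomp Require Import all_boot all_order all_algebra.
Set Implicit Arguments.
Unset Strict Implicit.
Unset Printing Implicit Defensive.
Import GRing.Theory.
Local Open Scope ring_scope.

Notation "x %:F" := (@FracField.tofrac _ x) : ring_scope.

(* `A <= B` as a bare relation on sets, for use with flags, sort, ... *)
Definition incl (E : finType) : rel {set E} := fun A B => A \subset B.

(* All chains for le inside A, the empty one included. *)
Definition flags (T : finType) (le : rel T) (A : {set T}) : {set {set T}} :=
  [set F : {set T} | (F \subset A) &&
                     [forall x in F, forall y in F, le x y || le y x]].

(* Lattices are given as families L of subsets of E, ordered by inclusion.    *)
(* These definitions are meant for L a lattice of flats or an interval in one *)
(* (such a family is closed under intersection and has a greatest element).   *)
Section SetLattice.
Variables (E : finType) (L : {set {set E}}).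

Definition lbot : {set E} := \bigcap_(Z in L) Z.
Definition ltop : {set E} := \bigcup_(Z in L) Z.

(* The largest h such that there is a chain Z_0 < ... < Z_(h-1) < X in L. *)
Definition lrank (X : {set E}) : nat :=
  \max_(F in flags (@incl E) [set Z in L | Z \proper X]) #|F|.

Fixpoint mobius_fuel (n : nat) (X : {set E}) : int :=
  if n isn't n'.+1 then 0 else
  if X == lbot then 1 else - \sum_(Z in L | Z \proper X) mobius_fuel n' Z.

(* The fuel #|X|.+1 is always enough; see mobiusE. *)
Definition mobius (X : {set E}) : int := mobius_fuel #|X|.+1 X.

Lemma mobius_fuelE n (X : {set E}) : (#|X| < n)%N -> mobius_fuel n X = mobius X.
Proof.
suff eqmn m : (#|X| < m)%N -> (#|X| < n)%N -> mobius_fuel n X = mobius_fuel m X.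
  exact: eqmn.
elim: n m X => [//|n IH] [//|m] X ltXm ltXn /=.
case: ifP => // _; congr (- _); apply: eq_bigr => Z /andP[_ ZX].
have ltZX := proper_card ZX.
by apply: IH; [exact: leq_trans ltZX ltXm | exact: leq_trans ltZX ltXn].
Qed.

Lemma mobiusE (X : {set E}) :
  mobius X = if X == lbot then 1 else - \sum_(Z in L | Z \proper X) mobius Z.
Proof.
rewrite {1}/mobius /=; case: ifP => // _; congr (- _); apply: eq_bigr => Z.
by case/andP=> _ ZX; apply: mobius_fuelE; exact: proper_card.
Qed.

Definition poincare : {poly int} :=
  \sum_(X in L) mobius X *: (- 'X) ^+ lrank X.

Definition interval (X X' : {set E}) : {set {set E}} :=
  [set Z in L | (X \subset Z) && (Z \subset X')].

Definition proper_part : {set {set E}} := L :\ lbot :\ ltop.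

(* X_0 = bottom, X_1 < ... < X_l the elements of F, X_(l+1) = top. *)
Definition flag_seq (F : {set {set E}}) : seq {set E} :=
  lbot :: rcons (sort (@incl E) (enum F)) ltop.

End SetLattice.

(* Matroids on E, axiomatized by their flats: the flats covering a flat F     *)
(* partition the complement of F. (Uniqueness of F' follows from flatsI.)     *)
Record matroid (E : finType) := Matroid {
  flats :> {set {set E}};
  flatsT : [set: E] \in flats;
  flatsI : forall F G, F \in flats -> G \in flats -> F :&: G \in flats;
  flats_cover : forall F e, F \in flats -> e \notin F ->
    exists F', [/\ F' \in flats, e |: F \subset F'
      & forall G, G \in flats -> F \proper G -> G \subset F' -> G = F']
}.

Section Matroid.
Variables (E : finType) (M : matroid E).

Definition mrank : nat := lrank M (ltop M).

(* pi_F(Y). The lattice of flats of the minor M / X | X' is represented by    *)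
(* the isomorphic interval [X, X'] of the lattice of flats of M.              *)
Definition flag_poincare (F : {set {set E}}) : {poly int} :=
  \prod_(k < #|F|.+1)
    poincare (interval M (nth set0 (flag_seq M F) k)
                         (nth set0 (flag_seq M F) k.+1)).

(* N_M(Y, T), as a polynomial in Y (outer variable) with coefficients in      *)
(* Z[T] (inner variable), so that N_M(1, T) is coarse_flag_poly.[1].          *)
Definition coarse_flag_poly : {poly {poly int}} :=
  \sum_(F in flags (@incl E) (proper_part M))
    (flag_poincare F)^:P * ('X ^+ #|F| * (1 - 'X) ^+ (mrank - 1 - #|F|))%:P.

End Matroid.

Inductive sign := SZero | SPlus | SMinus.

Definition sign_code (s : sign) : option bool :=
  match s with SZero => None | SPlus => Some true | SMinus => Some false end.
Definition sign_decode (c : option bool) : sign :=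
  match c with None => SZero | Some true => SPlus | Some false => SMinus end.
Lemma sign_codeK : cancel sign_code sign_decode. Proof. by case. Qed.
HB.instance Definition _ := Finite.copy sign (can_type sign_codeK).

Definition sign_opp (s : sign) : sign :=
  match s with SZero => SZero | SPlus => SMinus | SMinus => SPlus end.

Section SignVectors.
Variable E : finType.
Notation signvec := {ffun E -> sign}.

Definition sv0 : signvec := [ffun=> SZero].
Definition sv_opp (X : signvec) : signvec := [ffun e => sign_opp (X e)].
Definition sv_comp (X Y : signvec) : signvec :=
  [ffun e => if X e == SZero then Y e else X e].
Definition sv_sep (X Y : signvec) : {set E} :=
  [set e | (X e != SZero) && (Y e == sign_opp (X e))].
Definition sv_zeros (X : signvec) : {set E} := [set e | X e == SZero].
Definition sv_le : rel signvec := fun X Y =>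
  [forall e, (X e == SZero) || (X e == Y e)].
Definition sv_lt : rel signvec := fun X Y => (X != Y) && sv_le X Y.

End SignVectors.

Record oriented_matroid (E : finType) := OrientedMatroid {
  covectors :> {set {ffun E -> sign}};
  cov0 : sv0 E \in covectors;
  covN : forall X, X \in covectors -> sv_opp X \in covectors;
  cov_comp : forall X Y,
    X \in covectors -> Y \in covectors -> sv_comp X Y \in covectors;
  cov_elim : forall X Y e,
    X \in covectors -> Y \in covectors -> e \in sv_sep X Y ->
    exists Z, [/\ Z \in covectors, Z e = SZero
      & forall f, f \notin sv_sep X Y -> Z f = sv_comp X Y f]
}.

Section OrientedMatroid.
Variables (E : finType) (M : oriented_matroid E).

Definition om_flats : {set {set E}} := [set sv_zeros X | X in covectors M].

Lemma om_flatsT : [set: E] \in om_flats.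
Proof.
apply/imsetP; exists (sv0 E); first exact: cov0.
by apply/setP=> e; rewrite !inE ffunE eqxx.
Qed.

Lemma om_flatsI F G : F \in om_flats -> G \in om_flats -> F :&: G \in om_flats.
Proof.
case/imsetP=> X CX -> /imsetP[Y CY ->]; apply/imsetP.
exists (sv_comp X Y); first exact: cov_comp.
by apply/setP=> e; rewrite !inE ffunE; case: (X e).
Qed.

Lemma om_flats_elim F G e g :
    F \in om_flats -> G \in om_flats -> F \subset G ->
    e \notin G -> g \in G -> g \notin F ->
  exists H, [/\ H \in om_flats, e |: F \subset H & g \notin H].
Proof.
case/imsetP=> X CX -> /imsetP[Y0 CY0 ->] XY.
wlog: Y0 CY0 XY / (X e == SZero) || (Y0 e == sign_opp (X e)) => [wl|].
  have [|nXY] := boolP ((X e == SZero) || (Y0 e == sign_opp (X e))).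
    exact: wl.
  have zN : sv_zeros (sv_opp Y0) = sv_zeros Y0.
    by apply/setP=> x; rewrite !inE ffunE; case: (Y0 x).
  move=> eY gY gX; rewrite -zN in XY eY gY; apply: (wl _ _ XY) => //.
    exact: covN.
  move: nXY eY; rewrite inE !ffunE.
  by case: (X e); case: (Y0 e).
move=> sXY eY gY gX; have eX : e \notin sv_zeros X by apply: contra eY => /(subsetP XY).
have eS : e \in sv_sep X Y0.
  by move: sXY eX; rewrite !inE => /orP[->|->] // ->.
have [Z [CZ Ze Zf]] := cov_elim CX CY0 eS.
exists (sv_zeros Z); split; first exact: imset_f.
  apply/subsetP=> f; rewrite in_setU1 => /orP[/eqP->|fX].
    by rewrite inE Ze.
  have fY := subsetP XY _ fX; move: fX fY; rewrite !inE => /eqP fX /eqP fY.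
  by rewrite Zf ?inE ?ffunE fX ?eqxx ?fY.
move: gX gY; rewrite !inE => gX /eqP gY.
by rewrite Zf ?inE ?ffunE gY (negPf gX) //=; case: (X g) gX.
Qed.

Lemma om_flats_cover F e : F \in om_flats -> e \notin F ->
  exists F', [/\ F' \in om_flats, e |: F \subset F'
    & forall G, G \in om_flats -> F \proper G -> G \subset F' -> G = F'].
Proof.
move=> LF eF; pose F' := \bigcap_(H in om_flats | e |: F \subset H) H.
have sF' H : H \in om_flats -> e |: F \subset H -> F' \subset H.
  by move=> LH eFH; apply: bigcap_inf; rewrite LH.
have eFF' : e |: F \subset F' by apply/bigcapsP=> H /andP[].
exists F'; split=> // [|G LG /properP[FG [g gG gF]] GF'].
  apply: (big_ind (fun H => H \in om_flats)); first exact: om_flatsT.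
    exact: om_flatsI.
  by move=> H /andP[].
apply/eqP; rewrite eqEsubset GF' sF' // subUset FG andbT sub1set.
apply: contraT => eG.
have [H [LH eFH /negP[]]] := om_flats_elim LF LG FG eG gG gF.
by apply: (subsetP (sF' H LH eFH)); apply: (subsetP GF').
Qed.

Definition underlying_matroid : matroid E :=
  Matroid om_flatsT om_flatsI om_flats_cover.

Definition om_rank : nat := mrank underlying_matroid.

Definition topes : {set {ffun E -> sign}} :=
  [set tau in covectors M | [forall Y in covectors M, ~~ sv_lt tau Y]].

(* Sigma(tau). The top element added to the covectors in the face lattice is  *)
(* never below tau, so the open interval (0, tau) consists of covectors.      *)
Definition tope_complex (tau : {ffun E -> sign}) :
    {set {set {ffun E -> sign}}} :=
  flags (@sv_le E) [set X in covectors M | sv_lt (sv0 E) X && sv_lt X tau].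

Definition tope_f (tau : {ffun E -> sign}) : {poly int} :=
  \poly_(k < om_rank) (#|[set F in tope_complex tau | #|F| == k]|)%:R.

(* (1 - T)^(r-1) f(T / (1 - T)), in the fraction field of Z[T]. *)
Definition tope_h (tau : {ffun E -> sign}) : {fraction {poly int}} :=
  let T : {fraction {poly int}} := ('X : {poly int})%:F in
  (1 - T) ^+ (om_rank - 1) * (map_poly intr (tope_f tau)).[T / (1 - T)].

End OrientedMatroid.

(* Main.v *)
Require Import Defs.
From mathcomp Require Import all_boot all_order all_algebra.
Import GRing.Theory.
Local Open Scope ring_scope.
Set Implicit Arguments.
Unset Strict Implicit.
Unset Printing Implicit Defensive.

(** Write w(k) = T^k (1-T)^(r-1-k). Expanding h(Sigma(tau); T) shows that it is
    the sum of w(|G|) over the flags G of covectors strictly between 0 and tau,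
    since such a flag has fewer than r elements. The right-hand side is
    therefore a sum over the pairs (tau, G). Taking zero sets reverses the
    order and is injective on chains, so it turns G into a flag F of flats of
    the same size in the proper part of the lattice of flats; the topes are the
    covectors whose zero set is the bottom flat. Grouping the pairs by F, it
    remains to see that pi_F(1) counts the pairs lying over F.

    Building such a chain of covectors downwards in the lattice of flats, that
    is, from the covector 0 up to the tope, each step extends a covector G to a
    covector Y >= G with a prescribed zero set X inside the zero set X' of G.
    The number of choices for Y depends only on X and X': it is the value at 1
    of the Poincare polynomial of [X, X'] (las_vergnas_zaslavsky, the theorem
    of Las Vergnas and Zaslavsky on the number of topes, applied to the minor
    of X and X'). Multiplying over the steps gives pi_F(1)
    (sum_chain_count, card_flags_zeros).

    The tope count follows by Moebius inversion from an Euler relation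
    (covector_euler): for a flat Z inside the zero set of G, the sum of
    (-1)^(rank of the zero set of Y) over the covectors Y >= G vanishing on Z
    is (-1)^(rank of Z). This is proved by adding the elements of the zero set
    of G outside Z one at a time, starting with Z alone, where the zero vector
    is the only term. When e is added, a restricted covector extends either in
    exactly one way without changing the closure of its zero set, or in all
    three ways 0, +, -; in the latter case the extension by 0 raises the rank
    of the zero set by one, so that the three signs add up to the old one.
    That the rank goes up there means that the length of the longest chain
    below a flat increases by exactly one along a covering relation
    (lrank_covers), which rests on a Steinitz exchange argument. *)

(** * Closure and exchange in a matroid given by its flats *)

(* Intervals of a family of sets, as opposed to intervals of an ordered type. *)
Local Notation interval := Defs.interval.

Definition covers (E : finType) (L : {set {set E}}) (F F' : {set E}) : Prop :=
  [/\ F \in L, F' \in L, F \proper F'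
    & forall G, G \in L -> F \proper G -> G \subset F' -> G = F'].

Section Closure.
Variables (E : finType) (M : matroid E).
Implicit Types (S F G X Z : {set E}).

Definition closure S : {set E} := \bigcap_(F in M | S \subset F) F.

Lemma closure_flat S : closure S \in flats M.
Proof.
apply: (big_ind (fun H => H \in flats M)); first exact: flatsT.
  exact: flatsI.
by move=> H /andP[].
Qed.

Lemma sub_closure S : S \subset closure S.
Proof. by apply/bigcapsP=> F /andP[]. Qed.

Lemma closure_min S F : F \in flats M -> S \subset F -> closure S \subset F.
Proof. by move=> MF SF; apply: bigcap_inf; rewrite MF. Qed.

Lemma closure_sub S S' : S \subset closure S' -> closure S \subset closure S'.
Proof. exact: closure_min (closure_flat S'). Qed.

Lemma closure_id F : F \in flats M -> closure F = F.
Proof. by move=> MF; apply/eqP; rewrite eqEsubset closure_min // sub_closure. Qed.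

Lemma closureU1 S e : closure (e |: closure S) = closure (e |: S).
Proof.
apply/eqP; rewrite eqEsubset; apply/andP; split; apply: closure_sub.
  rewrite subUset sub1set (subsetP (sub_closure _)) ?setU11 //=.
  by apply: closure_sub; apply: subset_trans (subsetUr _ _) (sub_closure _).
by apply: subset_trans (sub_closure _); rewrite setUS // sub_closure.
Qed.

Lemma closure_covers F e :
  F \in flats M -> e \notin F -> covers M F (closure (e |: F)).
Proof.
move=> MF eF; have [F' [MF' sF' minF']] := flats_cover MF eF.
have FP S : F \subset S -> e \in S -> F \proper S.
  by move=> FS eS; apply/properP; split=> //; exists e.
have eFc := sub_closure (e |: F).
rewrite subUset sub1set in eFc; case/andP: eFc => ec Fc.
have -> : closure (e |: F) = F'.
  by apply: minF'; [exact: closure_flat | exact: FP | exact: closure_min].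
by split=> //; apply: FP; move: sF'; rewrite subUset sub1set => /andP[].
Qed.

Lemma closure_exchange F e x : F \in flats M ->
  x \notin F -> x \in closure (e |: F) -> e \in closure (x |: F).
Proof.
move=> MF xF xe; have eF : e \notin F.
  by apply: contra xF => eF; move: xe; rewrite (setUidPr _) ?sub1set ?closure_id.
have [_ _ FF' minF'] := closure_covers MF eF.
have [_ Mx Fx _] := closure_covers MF xF.
rewrite (minF' _ Mx Fx); first by apply: (subsetP (sub_closure _)); rewrite setU11.
apply: closure_sub; rewrite subUset sub1set xe /=.
exact: subset_trans (subsetUr _ _) (sub_closure _).
Qed.

(** The entry of s to be dropped in favour of z is the first one that, together
    with Z and the entries before it, spans z. *)
Lemma closure_exchange_seq (s : seq E) Z z : Z \in flats M ->
    z \notin Z -> z \in closure (Z :|: [set:: s]) ->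
  exists2 s', size s = (size s').+1 &
    Z :|: [set:: s] \subset closure ((z |: Z) :|: [set:: s']).
Proof.
elim: s Z => [|a s IHs] Z MZ zZ.
  by rewrite set_nil setU0 closure_id // (negPf zZ).
have subZ2 : Z \subset closure (a |: Z).
  exact: subset_trans (subsetUr _ _) (sub_closure _).
have [za _|za zs] := boolP (z \in closure (a |: Z)).
  exists s => //; have az := closure_exchange MZ zZ za.
  rewrite set_cons setUCA subUset sub1set; apply/andP; split.
    apply: (subsetP _ _ az); apply: closure_sub.
    exact: subset_trans (subsetUl _ _) (sub_closure _).
  by apply: subset_trans (sub_closure _); rewrite setSU // subsetUr.
have [|s' sz_s sub_s] := IHs (closure (a |: Z)) (closure_flat _) za.
  apply: (subsetP _ _ zs); apply: closure_sub; rewrite set_cons setUCA setUA.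
  apply: subset_trans (sub_closure _); rewrite setSU //; exact: sub_closure.
exists (a :: s'); first by rewrite /= sz_s.
have sub1 : a |: Z :|: [set:: s] \subset
    closure (z |: closure (a |: Z) :|: [set:: s']).
  by apply: subset_trans sub_s; rewrite setSU // sub_closure.
rewrite set_cons setUCA setUA; apply: subset_trans sub1 _.
apply: closure_sub; rewrite !subUset sub1set -andbA; apply/and3P; split.
- by apply: (subsetP (sub_closure _)); rewrite !inE eqxx.
- apply: closure_sub; apply: subset_trans (sub_closure _).
  by rewrite set_cons; apply/subsetP=> x; rewrite !inE => /orP[->|->]; rewrite ?orbT.
- apply: subset_trans (sub_closure _).
  by apply/subsetP=> x; rewrite !inE => ->; rewrite ?orbT.
Qed.

Definition pincl : rel {set E} := fun A B => A \proper B.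

Lemma pincl_trans : transitive pincl.
Proof. by move=> B A C; exact: proper_trans. Qed.

(** Each step of the chain uses up one entry of s, which is exchanged for an
    element of the next flat. Starting at an arbitrary flat Z rather than at the
    bottom is what makes the induction on the chain work, and later allows
    ranks to be computed inside an interval. *)
Lemma steinitz (zs : seq {set E}) Z (s : seq E) : Z \in flats M ->
    {subset zs <= flats M} -> path pincl Z zs ->
    last Z zs \subset closure (Z :|: [set:: s]) ->
  (size zs <= size s)%N.
Proof.
elim: zs Z s => [//|Z1 zs IHs] Z s MZ Mzs /= /andP[ZZ1 pzs] lastZ.
have [sZZ1 [z zZ1 zZ]] := properP ZZ1.
have MZ1 : Z1 \in flats M by apply: Mzs; rewrite mem_head.
have subZ1 : Z1 \subset last Z1 zs.
  have := order_path_min pincl_trans pzs; case: zs {IHs Mzs pzs lastZ} => [//|Z2 zs].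
  by move/allP/(_ _ (mem_last _ _))/proper_sub.
have [s' -> sub_s] :=
  closure_exchange_seq MZ zZ (subsetP lastZ _ (subsetP subZ1 _ zZ1)).
rewrite ltnS; apply: (IHs Z1) => //.
  by move=> W Ws; apply: Mzs; rewrite inE Ws orbT.
apply: subset_trans lastZ _; apply: closure_sub; apply: subset_trans sub_s _.
apply: closure_sub; apply: subset_trans (sub_closure _).
by rewrite setSU // subUset sub1set zZ1.
Qed.

End Closure.

(** * Chains and ranks *)

Lemma flagsU1 (T : finType) (le : rel T) (A B : {set T}) x F :
    reflexive le -> F \in flags le A -> x |: A \subset B ->
    {in F, forall y, le x y || le y x} ->
  x |: F \in flags le B.
Proof.
move=> le_refl; rewrite inE => /andP[FA /forall_inP totF] AB cmp_x; rewrite inE.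
rewrite (subset_trans _ AB) ?setUS //=.
apply/forall_inP=> y; rewrite in_setU1 => xFy.
apply/forall_inP=> z; rewrite in_setU1 => xFz.
have [->|Fy] := predU1P xFy; have [->|Fz] := predU1P xFz.
- by rewrite le_refl.
- exact: cmp_x.
- by rewrite orbC cmp_x.
- by move/forall_inP: (totF y Fy) => /(_ z Fz).
Qed.

Section Flags.
Variable E : finType.
Implicit Types (A F : {set {set E}}).

Lemma flag_sorted A F : F \in flags (@incl E) A ->
  sorted (@pincl E) (sort (@incl E) (enum F)).
Proof.
rewrite inE => /andP[_ /forall_inP totF].
have tot : {in enum F &, total (@incl E)}.
  move=> X Y; rewrite !mem_enum => FX FY.
  by move/forall_inP: (totF X FX) => /(_ Y FY).
have inclT : transitive (@incl E) by move=> Y X Z; exact: subset_trans.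
have sF := sort_sorted_in tot (allss (enum F)).
have uF : uniq (sort (@incl E) (enum F)) by rewrite sort_uniq enum_uniq.
move: sF uF; case: (sort _ _) => [//|X s] /=.
elim: s X => [//|Y s IHs] X /= /andP[XY pY] /andP[nX uY].
rewrite (IHs _ pY uY) andbT /pincl properEneq; apply/andP; split=> //.
by apply: contra nX => /eqP->; rewrite mem_head.
Qed.

Lemma mem_flag_sort F (X : {set E}) : (X \in sort (@incl E) (enum F)) = (X \in F).
Proof. by rewrite mem_sort mem_enum. Qed.

Lemma size_flag_sort F : size (sort (@incl E) (enum F)) = #|F|.
Proof. by rewrite size_sort -cardE. Qed.

Lemma lrank_ltn (L : {set {set E}}) (X X' : {set E}) : X \in L -> X \proper X' ->
  (lrank L X < lrank L X')%N.
Proof.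
move=> LX XX'.
have [|F fF ltX] := @eq_bigmax_cond _
    (mem (flags (@incl E) [set Z in L | Z \proper X])) (fun F : {set {set E}} => #|F|).
  apply/card_gt0P; exists set0.
  by rewrite inE sub0set; apply/forall_inP=> x; rewrite inE.
rewrite {1}/lrank ltX; move: (fF); rewrite inE => /andP[/subsetP sF _].
have ltF Y : Y \in F -> Y \proper X by move/sF; rewrite inE => /andP[].
have nXF : X \notin F by apply/negP=> /ltF; rewrite properxx.
apply: (@leq_trans #|X |: F|); first by rewrite cardsU1 nXF.
rewrite /lrank; apply: (@leq_bigmax_cond _ _ (fun G : {set {set E}} => #|G|)).
apply: (flagsU1 _ fF) => [Y||Y FY]; first exact: subxx.
- apply/subsetP=> Y; rewrite !inE => /predU1P[->|/andP[-> YX]].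
    by rewrite LX XX'.
  exact: proper_trans YX XX'.
- by rewrite /incl (proper_sub (ltF _ FY)) orbT.
Qed.

End Flags.

Section Graded.
Variables (E : finType) (M : matroid E) (X X' : {set E}).
Hypothesis MX : X \in flats M.
Let L := interval M X X'.

Lemma mem_interval Z : (Z \in L) = [&& Z \in flats M, X \subset Z & Z \subset X'].
Proof. by rewrite inE. Qed.

(** A chain below F, completed by F itself, has as many steps as the chain has
    elements, so the exchange lemma bounds its length. *)
Lemma lrank_span F (s : seq E) :
  F \in flats M -> F \subset closure M (X :|: [set:: s]) -> (lrank L F <= size s)%N.
Proof.
move=> MF Fs; apply/bigmax_leqP=> G fG; have := flag_sorted fG.
rewrite -size_flag_sort.
have memG Z : Z \in sort (@incl E) (enum G) ->
    [/\ Z \in flats M, X \subset Z & Z \proper F].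
  rewrite mem_flag_sort; move: fG; rewrite inE => /andP[/subsetP sG _] /sG.
  by rewrite inE mem_interval => /andP[/and3P[]].
case: (sort _ _) memG => [//|Z zs] memG /= pzs.
have [MZ XZ ZF] := memG _ (mem_head _ _).
rewrite -(size_rcons zs F); apply: (steinitz MZ).
- move=> W; rewrite mem_rcons inE => /predU1P[->//|Ws].
  by have [] := memG W _; rewrite // inE Ws orbT.
- by rewrite rcons_path pzs; have [] := memG _ (mem_last _ _).
- rewrite last_rcons; apply: subset_trans Fs _; apply: closure_sub.
  by apply: subset_trans (sub_closure _ _); rewrite setSU.
Qed.

(** By induction on F: a maximal flat F1 of the interval properly inside F has
    smaller rank, and F is spanned by F1 and any single element of F outside
    it. *)
Lemma exists_span F : F \in L ->
  exists2 s : seq E, F \subset closure M (X :|: [set:: s]) & (size s <= lrank L F)%N.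
Proof.
have [n] := ubnP #|F|; elim: n F => // n IHn F leFn LF.
have:= LF; rewrite mem_interval => /and3P[MF XF FX'].
have [->|neqXF] := eqVneq F X.
  by exists [::] => //; rewrite set_nil setU0 sub_closure.
have PX : (X \in L) && (X \proper F).
  rewrite mem_interval MX subxx (subset_trans XF FX') properEneq eq_sym neqXF.
  exact: XF.
have [F1 /andP[LF1 F1F] maxF1] :=
  arg_maxnP (P := fun Z => (Z \in L) && (Z \proper F)) (fun Z : {set E} => #|Z|) PX.
have [s sF1 sz_s] := IHn F1 (leq_trans (proper_card F1F) leFn) LF1.
have [sF1F [e eF eF1]] := properP F1F.
have:= LF1; rewrite mem_interval => /and3P[MF1 XF1 _].
have [_ Mc F1c _] := closure_covers MF1 eF1.
have cF : closure M (e |: F1) \subset F by rewrite closure_min // subUset sub1set eF.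
exists (e :: s); last exact: leq_ltn_trans sz_s (lrank_ltn LF1 F1F).
have -> : F = closure M (e |: F1).
  apply/eqP; rewrite eq_sym; apply: contraLR (proper_card F1c) => neF.
  rewrite -leqNgt; apply: maxF1; rewrite properEneq neF cF mem_interval Mc.
  by rewrite (subset_trans cF FX') (subset_trans XF1 (proper_sub F1c)).
apply: closure_sub; rewrite set_cons setUCA subUset sub1set; apply/andP; split.
  by apply: (subsetP (sub_closure _ _)); rewrite setU11.
apply: subset_trans sF1 _; apply: closure_sub.
exact: subset_trans (subsetUr _ _) (sub_closure _ _).
Qed.

(** The flat F' is spanned by F and one more element, so the spanning list
    of F, extended by that element, bounds its rank. *)
Lemma lrank_covers F F' : F \in L -> F' \in L -> covers M F F' ->
  lrank L F' = (lrank L F).+1.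
Proof.
move=> LF LF' [MF MF' FF' minF']; apply/eqP; rewrite eqn_leq (lrank_ltn LF FF') andbT.
have [s sF sz_s] := exists_span LF.
have [sFF' [e eF' eF]] := properP FF'.
have [_ Mc Fc _] := closure_covers MF eF.
apply: leq_trans (lrank_span (s := e :: s) MF' _) _; last by [].
rewrite -(minF' _ Mc Fc); last by rewrite closure_min // subUset sub1set eF'.
apply: closure_sub; rewrite set_cons setUCA subUset sub1set; apply/andP; split.
  by apply: (subsetP (sub_closure _ _)); rewrite setU11.
apply: subset_trans sF _; apply: closure_sub.
exact: subset_trans (subsetUr _ _) (sub_closure _ _).
Qed.

End Graded.

(** * Sign vectors *)

Section SignVectorTheory.
Variable E : finType.
Implicit Types (X Y Z : {ffun E -> sign}) (A B : {set E}).

Lemma sv_leP X Y : reflect (forall e, X e <> SZero -> Y e = X e) (sv_le X Y).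
Proof.
apply: (iffP forallP) => XY e; have := XY e.
  by case/orP=> /eqP ->.
by case: eqP => //= nX XYe; rewrite XYe.
Qed.

Lemma sv_le_refl : reflexive (@sv_le E).
Proof. by move=> X; apply/sv_leP. Qed.

Lemma sv_le_trans : transitive (@sv_le E).
Proof.
move=> Y X Z /sv_leP XY /sv_leP YZ; apply/sv_leP=> e nX.
by rewrite YZ XY.
Qed.

Lemma mem_zeros X e : (e \in sv_zeros X) = (X e == SZero).
Proof. by rewrite inE. Qed.

Lemma sv_le_zeros X Y : sv_le X Y -> sv_zeros Y \subset sv_zeros X.
Proof.
move/sv_leP=> XY; apply/subsetP=> e; rewrite !mem_zeros; apply: contraLR.
by move=> nX; rewrite XY //; apply/eqP.
Qed.

Lemma sv_le_eq X Y : sv_le X Y -> sv_zeros X \subset sv_zeros Y -> X = Y.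
Proof.
move=> /sv_leP XY /subsetP sXY; apply/ffunP=> e.
have [X0|/eqP/XY //] := eqVneq (X e) SZero.
by rewrite X0; apply/esym/eqP; rewrite -mem_zeros sXY // mem_zeros X0.
Qed.

Lemma sv_le_comp X Y : sv_le X (sv_comp X Y).
Proof. by apply/sv_leP=> e; rewrite ffunE; case: eqP. Qed.

Lemma sv_zeros_comp X Y : sv_zeros (sv_comp X Y) = sv_zeros X :&: sv_zeros Y.
Proof. by apply/setP=> e; rewrite !inE ffunE; case: (X e). Qed.

Lemma sv_zeros_opp X : sv_zeros (sv_opp X) = sv_zeros X.
Proof. by apply/setP=> e; rewrite !inE ffunE; case: (X e). Qed.

Definition mask A X : {ffun E -> sign} := [ffun e => if e \in A then X e else SZero].

Lemma mask_mask A B X : B \subset A -> mask B (mask A X) = mask B X.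
Proof.
by move=> BA; apply/ffunP=> e; rewrite !ffunE; case: ifP => // /(subsetP BA) ->.
Qed.

Definition sv_set X e (a : sign) : {ffun E -> sign} :=
  [ffun f => if f == e then a else X f].

End SignVectorTheory.

(** * The Euler relation for covectors *)

Section Euler.
Variables (E : finType) (M : oriented_matroid E) (Z : {set E}).
Notation N := (underlying_matroid M).
Implicit Types (X Y : {ffun E -> sign}) (A B : {set E}).

Lemma zeros_flat X : X \in covectors M -> sv_zeros X \in flats N.
Proof. exact: imset_f. Qed.

Lemma flatP F : reflect (exists2 X, X \in covectors M & F = sv_zeros X) (F \in flats N).
Proof. exact: imsetP. Qed.

(** The covectors of the minor of M obtained by contracting Z and restricting
    to A, kept as sign vectors on E that vanish outside A, so that the ground
    set does not change along the induction. *)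
Definition minor_covectors A : {set {ffun E -> sign}} :=
  [set mask A X | X in covectors M & Z \subset sv_zeros X].

Lemma minorP A Y : reflect
  (exists X, [/\ X \in covectors M, Z \subset sv_zeros X & Y = mask A X])
  (Y \in minor_covectors A).
Proof.
apply: (iffP imsetP) => [[X]|[X [MX ZX ->]]]; last by exists X; rewrite // inE MX.
by rewrite inE => /andP[MX ZX] ->; exists X.
Qed.

(** The extensions to e |: B of a covector Y of the minor on B. They are
    determined by their sign a at e, and D a says that a occurs. *)
Section Fibre.
Variables (B : {set E}) (e : E) (Y : {ffun E -> sign}).
Hypotheses (ZB : Z \subset B) (eB : e \notin B) (BY : Y \in minor_covectors B).
Let S := sv_zeros Y :&: B.
Let D a := sv_set Y e a \in minor_covectors (e |: B).

Lemma fibreP a : reflect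
  (exists X, [/\ X \in covectors M, Z \subset sv_zeros X, Y = mask B X & X e = a]) (D a).
Proof.
have YB f : f \notin B -> Y f = SZero.
  by case/minorP: BY => X [_ _ ->] fB; rewrite ffunE (negPf fB).
apply: (iffP (minorP _ _)) => [[X [MX ZX YX]]|[X [MX ZX YX Xe]]].
  exists X; split=> //.
    apply/ffunP=> f; rewrite ffunE; case: ifPn => [fB|/YB //].
    move/ffunP/(_ f): YX; rewrite !ffunE in_setU1 fB orbT ifN //.
    by apply: contraNneq eB => <-.
  by move/ffunP/(_ e): YX; rewrite !ffunE setU11 eqxx.
exists X; split=> //; apply/ffunP=> f; rewrite YX !ffunE in_setU1.
by case: eqP => [->|//]; rewrite Xe.
Qed.

Lemma fibre_zeros X : Y = mask B X -> S = sv_zeros X :&: B.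
Proof.
rewrite /S => ->; apply/setP=> f; rewrite !inE ffunE.
by case: (f \in B); rewrite ?andbT ?andbF.
Qed.

Lemma fibre_nonempty : exists a, D a.
Proof.
by case/minorP: BY => X [MX ZX YX]; exists (X e); apply/fibreP; exists X.
Qed.

(** Covector elimination at e, which is the only element of B or e separating
    the two extensions. *)
Lemma fibre_elim : D SPlus -> D SMinus -> D SZero.
Proof.
case/fibreP=> X [MX ZX YX Xe] /fibreP[X' [MX' ZX' YX' X'e]].
have eq_B f : f \in B -> X' f = X f.
  by move=> fB; move/ffunP/(_ f): YX'; rewrite YX !ffunE fB.
have sepB f : f \in B -> f \notin sv_sep X X'.
  by move/eq_B=> eq_f; rewrite inE eq_f; case: (X f).
have eS : e \in sv_sep X X' by rewrite inE Xe X'e.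
have [W [MW We Wf]] := cov_elim MX MX' eS.
have WB f : f \in B -> W f = X f.
  by move=> fB; rewrite Wf ?sepB // ffunE eq_B //; case: eqP.
apply/fibreP; exists W; split=> //.
  apply/subsetP=> f Zf; rewrite mem_zeros WB ?(subsetP ZB) //.
  by rewrite -mem_zeros (subsetP ZX).
by rewrite YX; apply/ffunP=> f; rewrite !ffunE; case: ifP => // /WB.
Qed.

(** A covector of M restricting to such an extension has as its zero set a flat
    that contains S and misses e. *)
Lemma fibre_nonzero a : D a -> a != SZero -> e \notin closure N S.
Proof.
case/fibreP=> X [MX ZX YX <-] nXe; apply: contra nXe => eS.
rewrite -mem_zeros; apply: (subsetP _ _ eS); apply: closure_min (zeros_flat MX) _.
by rewrite (fibre_zeros YX) subsetIl.
Qed.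

(** Some covector vanishes exactly on the closure of S, hence not at e; it or its
    opposite, composed after the extension by 0, prescribes the sign at e
    without changing the signs on B. *)
Lemma fibre_split a : D SZero -> e \notin closure N S -> D a.
Proof.
move=> D0 eS; have [X0 [MX0 ZX0 YX0 X0e]] := fibreP _ D0.
have [->//|na] := eqVneq a SZero.
have /flatP[X1 MX1 clX1] := closure_flat N S.
have [X [MX zX Xe]] : exists X,
    [/\ X \in covectors M, sv_zeros X = sv_zeros X1 & X e = a].
  move: eS; rewrite clX1 mem_zeros => X1e.
  have [<-|nX1] := eqVneq (X1 e) a; first by exists X1.
  exists (sv_opp X1); split; [exact: covN | exact: sv_zeros_opp |].
  by rewrite ffunE; case: (X1 e) a X1e nX1 na => [] [].
apply/fibreP; exists (sv_comp X0 X); split; first exact: cov_comp.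
- rewrite sv_zeros_comp subsetI ZX0 zX -clX1.
  apply: subset_trans (sub_closure _ _).
  by rewrite (fibre_zeros YX0) subsetI ZX0.
- have SX : S \subset sv_zeros X by rewrite zX -clX1 sub_closure.
  rewrite YX0; apply/ffunP=> f; rewrite !ffunE; case: ifP => // fB.
  case: eqP => // X0f; rewrite X0f; apply/esym/eqP; rewrite -mem_zeros.
  by apply: (subsetP SX); rewrite (fibre_zeros YX0) !inE X0f eqxx.
- by rewrite ffunE X0e eqxx.
Qed.

(** Either there is a single extension, whose zero set has the same closure as
    S, or all three signs occur, and they contribute - s, s and s. *)
Lemma fibre_sum (s : {set E} -> int) :
    (e \notin closure N S -> s (closure N (e |: S)) = - s (closure N S)) ->
  \sum_(a : sign | D a) s (closure N (sv_zeros (sv_set Y e a) :&: (e |: B)))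
    = s (closure N S).
Proof.
move=> s_flip.
have zeros_set a : sv_zeros (sv_set Y e a) :&: (e |: B) =
    if a == SZero then e |: S else S.
  rewrite /S; case: a => /=; apply/setP=> f; rewrite !inE ffunE;
    by have [->|_] := eqVneq f e; rewrite ?(negPf eB) ?andbF.
under eq_bigr do rewrite zeros_set.
have sumE (G : sign -> int) : \sum_(a | D a) G a =
   (if D SZero then G SZero else 0) + (if D SPlus then G SPlus else 0)
     + (if D SMinus then G SMinus else 0).
  rewrite big_mkcond /= (bigD1 SZero) //= (bigD1 SPlus) //= (bigD1 SMinus) //=.
  by rewrite big1 ?addr0 ?addrA // => -[].
rewrite sumE /=.
have [eS|eS] := boolP (e \in closure N S).
  have n a : a != SZero -> D a = false.
    by move=> na; apply/negP=> /fibre_nonzero/(_ na); rewrite eS.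
  have [a Da] := fibre_nonempty.
  have D0 : D SZero by case: a Da => //; rewrite n.
  rewrite (n SPlus) // (n SMinus) // D0 !addr0.
  congr s; apply/eqP; rewrite eqEsubset; apply/andP; split.
    by apply: closure_sub; rewrite subUset sub1set eS sub_closure.
  by apply: closure_sub; exact: subset_trans (subsetUr _ _) (sub_closure _ _).
have [D0|nD0] := boolP (D SZero).
  have DE a : D a by exact: fibre_split.
  by rewrite !DE s_flip // addNr add0r.
have [a Da] := fibre_nonempty.
have [Dp|nDp] := boolP (D SPlus); have [Dm|nDm] := boolP (D SMinus).
- by rewrite fibre_elim in nD0.
- by rewrite add0r addr0.
- by rewrite !add0r.
- by case: a Da nD0 nDp nDm => ->.
Qed.

End Fibre.

(** Adding e to B splits the sum for e |: B into fibres over the covectors of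
    the minor on B, and fibre_sum collapses each fibre to the term of its base
    point. An arbitrary s that alternates along covering relations is allowed,
    so that ranks may be taken in any interval. *)
Lemma minor_euler A (s : {set E} -> int) : Z \in flats N -> Z \subset A ->
    (forall F e, F \in flats N -> Z \subset F -> e \in A -> e \notin F ->
       F \subset closure N A -> s (closure N (e |: F)) = - s F) ->
  \sum_(Y in minor_covectors A) s (closure N (sv_zeros Y :&: A)) = s Z.
Proof.
move=> NZ; have [n] := ubnP #|A :\: Z|; elim: n A => // n IHn A leA ZA s_flip.
have [AZ|[e eA]] := set_0Vmem (A :\: Z).
  have {AZ ZA leA}-> : A = Z by apply/eqP; rewrite eqEsubset ZA -setD_eq0 AZ eqxx.
  rewrite (big_pred1 (sv0 E)) => [|Y].
    rewrite (_ : _ :&: Z = Z) ?closure_id //; apply/setIidPr/subsetP=> f _.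
    by rewrite mem_zeros ffunE.
  apply/minorP/eqP => [[X [MX /subsetP ZX ->]]|->].
    by apply/ffunP=> f; rewrite !ffunE; case: ifP => // /ZX; rewrite mem_zeros => /eqP.
  exists (sv0 E); split; first exact: cov0.
    by apply/subsetP=> f _; rewrite mem_zeros ffunE.
  by apply/ffunP=> f; rewrite !ffunE; case: ifP.
move: eA; rewrite inE => /andP[eZ eA]; pose B := A :\ e.
have eB : e \notin B by rewrite setD11.
have defA : A = e |: B by rewrite setD1K.
have BA : B \subset A by rewrite subD1set.
have ZB : Z \subset B by rewrite subsetD1 ZA.
rewrite -(IHn B) // => [||F f NF ZF fB fF FB]; first 1 last.
- rewrite -ltnS; apply: leq_trans leA; rewrite ltnS.
  apply: proper_card; apply/properP; split; first exact: setSD.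
  by exists e; rewrite !inE ?eqxx ?eZ ?andbF.
- apply: s_flip => //; first exact: (subsetP BA).
  by apply: subset_trans FB _; apply: closure_sub; apply: subset_trans BA (sub_closure _ _).
rewrite (partition_big (mask B) (mem (minor_covectors B))) /= => [|Y]; last first.
  case/minorP=> X [MX ZX ->]; apply/minorP; exists X; split=> //.
  by rewrite mask_mask.
apply: eq_bigr => Y BY; rewrite -(fibre_sum (s := s) ZB eB BY); last first.
  move=> eS; rewrite -closureU1; apply: s_flip => //; first exact: closure_flat.
    apply: subset_trans (sub_closure _ _).
    by case/minorP: BY => X [_ ZX YX]; rewrite (fibre_zeros YX) subsetI ZX.
  apply: closure_sub; apply: subset_trans (sub_closure _ _).
  by apply: subset_trans (subsetIr _ _) BA.
have YB f : f \notin B -> Y f = SZero.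
  by case/minorP: BY => X [_ _ ->] fB; rewrite ffunE (negPf fB).
rewrite (reindex_onto (sv_set Y e) (fun X => X e)) /=; last first.
  move=> X /andP[/minorP[X1 [_ _ ->]] /eqP YX]; apply/ffunP=> f.
  rewrite !ffunE; case: eqP => [->//|/eqP nfe]; rewrite -YX !ffunE.
  by rewrite defA in_setU1 (negPf nfe); case: (f \in B).
rewrite -defA; apply: eq_bigl => a; rewrite ffunE eqxx /= eqxx andbT.
rewrite andb_idr // => _; apply/eqP/ffunP=> f; rewrite !ffunE.
case: ifPn => [fB|/YB//]; rewrite ifN //.
by apply: contraNneq eB => <-.
Qed.

End Euler.

(** * Moebius inversion *)

Lemma lbot_min (E : finType) (L : {set {set E}}) X :
  X \in L -> (forall Z, Z \in L -> X \subset Z) -> lbot L = X.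
Proof.
move=> LX minX; apply/eqP; rewrite eqEsubset bigcap_inf //=.
by apply/bigcapsP=> Z; exact: minX.
Qed.

Lemma sum_mobius (E : finType) (L : {set {set E}}) W : W \in L ->
  \sum_(Z in L | Z \subset W) mobius L Z = (W == lbot L)%:R.
Proof.
move=> LW; rewrite (bigD1 W) ?LW ?subxx //= [in mobius L W]mobiusE.
have defP Z : (Z \in L) && (Z \subset W) && (Z != W) = (Z \in L) && (Z \proper W).
  by rewrite -andbA; congr (_ && _); rewrite properEneq andbC.
rewrite (eq_bigl _ _ defP); case: eqVneq => [defW|_]; last by rewrite addNr.
rewrite big1 ?addr0 // => Z /andP[LZ ZW].
suff: W \subset Z by rewrite properE in ZW; case/andP: ZW => _ /negPf->.
by rewrite defW; apply: bigcap_inf.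
Qed.

Section Topes.
Variables (E : finType) (M : oriented_matroid E).
Notation N := (underlying_matroid M).
Implicit Types (G X Y tau : {ffun E -> sign}) (Z F : {set E}).

(** The covectors above G that vanish on Z correspond to the covectors of the
    minor on the zero set of G; the inverse of the restriction is composition
    after G. *)
Lemma covector_euler G Z (s : {set E} -> int) :
    G \in covectors M -> Z \in flats N -> Z \subset sv_zeros G ->
    (forall F F', Z \subset F -> F' \subset sv_zeros G -> covers N F F' ->
       s F' = - s F) ->
  \sum_(Y in M | sv_le G Y && (Z \subset sv_zeros Y)) s (sv_zeros Y) = s Z.
Proof.
move=> MG NZ ZG s_flip; set A := sv_zeros G.
have NA : A \in flats N by exact: zeros_flat.
rewrite -(minor_euler NZ ZG) => [|F e NF ZF eA eF FA]; last first.
  apply: s_flip => //; last exact: closure_covers.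
  by apply: closure_min => //; rewrite subUset sub1set eA; rewrite closure_id in FA.
have -> : minor_covectors M Z A =
    mask A @: [set Y in covectors M | sv_le G Y && (Z \subset sv_zeros Y)].
  apply/setP=> Y; apply/minorP/imsetP=> [[X [MX ZX ->]]|[X]]; last first.
    by rewrite inE => /and3P[MX _ ZX] ->; exists X.
  exists (sv_comp G X).
    by rewrite inE cov_comp // sv_le_comp sv_zeros_comp subsetI ZG.
  apply/ffunP=> e; rewrite !ffunE; case: ifP => //.
  by rewrite mem_zeros => ->.
rewrite big_imset /=; last first.
  move=> X Y; rewrite !inE => /and3P[_ /sv_leP GX _].
  case/and3P=> _ /sv_leP GY _ eqXY.
  apply/ffunP=> e; move/ffunP/(_ e): eqXY; rewrite !ffunE mem_zeros.
  by case: eqP => // nG _; rewrite GX // GY.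
apply: eq_big => Y; first by rewrite inE.
case/and3P=> MY GY _; congr s.
rewrite -{1}(closure_id (zeros_flat MY)); congr closure.
have sYA := subsetP (sv_le_zeros GY).
apply/setP=> e; rewrite !inE ffunE.
have := sYA e; rewrite !mem_zeros.
by case: (G e == SZero); rewrite ?andbT ?andbF; case: (Y e == SZero) => // /(_ isT).
Qed.

(** The value at 1 is the sum of mu(Z, W) (-1)^(rank of W) over the flats W of
    the interval. Replacing each sign by the Euler relation for W and
    exchanging the sums leaves, for each covector Y, the sum of mu(Z, W) over
    the flats W between Z and the zero set of Y, which vanishes unless the two
    coincide. *)
Lemma las_vergnas_zaslavsky G Z :
    G \in covectors M -> Z \in flats N -> Z \subset sv_zeros G ->
  (poincare (interval N Z (sv_zeros G))).[1] =
    #|[set Y in covectors M | sv_le G Y && (sv_zeros Y == Z)]|%:R.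
Proof.
move=> MG NZ ZG; set L := interval _ _ _.
pose s F : int := (-1) ^+ lrank L F.
have LZ : Z \in L by rewrite inE NZ subxx.
have botL : lbot L = Z by apply: lbot_min => // W; rewrite inE => /and3P[].
have sZ : s Z = 1.
  rewrite /s (_ : lrank L Z = 0%N) //; apply/eqP; rewrite -leqn0.
  by apply: (@lrank_span _ _ Z (sv_zeros G) Z [::] NZ); rewrite set_nil setU0 sub_closure.
have euler W : W \in L ->
    \sum_(Y in M | sv_le G Y && (W \subset sv_zeros Y)) s (sv_zeros Y) = s W.
  rewrite inE => /and3P[NW ZW WG]; apply: covector_euler => // F F' WF F'G cov.
  have [NF NF' FF' _] := cov; have ZF := subset_trans ZW WF.
  have LF : F \in L by rewrite inE NF ZF (subset_trans (proper_sub FF')).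
  have LF' : F' \in L by rewrite inE NF' F'G (subset_trans ZF (proper_sub FF')).
  by rewrite /s (lrank_covers NZ LF LF' cov) exprS mulN1r.
have -> : (poincare L).[1] = \sum_(W in L) mobius L W * s W.
  rewrite horner_sum; apply: eq_bigr => W _.
  by rewrite hornerZ horner_exp hornerN hornerX.
under eq_bigr => W LW do rewrite -(euler W LW) mulr_sumr.
rewrite (exchange_big_dep (fun Y => (Y \in covectors M) && sv_le G Y)) /=; last first.
  by move=> W Y _ /and3P[-> ->].
transitivity (\sum_(Y in M | sv_le G Y) (sv_zeros Y == Z)%:R * s (sv_zeros Y)).
  apply: eq_bigr => Y /andP[MY GY]; rewrite -mulr_suml.
  under eq_bigl => W do rewrite MY GY /=.
  have [ZY|nZY] := boolP (Z \subset sv_zeros Y).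
    by rewrite sum_mobius ?botL // inE zeros_flat // ZY sv_le_zeros.
  rewrite big1 => [|W /andP[LW WY]].
    by case: eqP nZY => [->|]; rewrite ?subxx.
  case/negP: nZY; apply: subset_trans WY.
  by move: LW; rewrite inE => /and3P[].
rewrite -sum1_card natr_sum big_mkcond [RHS]big_mkcond /=; apply: eq_bigr => Y _.
rewrite inE andbA; case: ifP => //= _.
by case: eqP => [->|]; rewrite ?sZ ?mulr1 ?mul0r.
Qed.

(** * Chains of covectors over a chain of flats *)

(** The number of chains of covectors below tau whose zero sets are the entries
    of s, listed from the covector closest to tau downwards; s is increasing. *)
Fixpoint chain_count tau (s : seq {set E}) : nat :=
  if s is F :: s' then
    \sum_(G in M | sv_le G tau && (sv_zeros G == F)) chain_count G s'
  else 1.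

Lemma zeros_inj_flag A Gs : Gs \in flags (@sv_le E) A ->
  {in Gs &, injective (@sv_zeros E)}.
Proof.
rewrite inE => /andP[_ /forall_inP tot] X Y GX GY eqz.
move/forall_inP: (tot X GX) => /(_ Y GY) /orP[] le.
  by apply: (sv_le_eq le); rewrite eqz.
by apply/esym; apply: (sv_le_eq le); rewrite eqz.
Qed.

(** Removing from a flag its largest covector G, the one lying over the first
    flat of s, leaves a flag below G lying over the rest of s. *)
Lemma card_flags_zeros tau s : path (@pincl E) (sv_zeros tau) (rcons s setT) ->
  #|[set Gs in tope_complex M tau | (@sv_zeros E) @: Gs == [set:: s]]|
    = chain_count tau s.
Proof.
elim: s tau => [|F s IHs] tau /=.
  move=> _; apply/eqP/cards1P; exists set0; apply/setP=> Gs.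
  rewrite !inE set_nil imset_eq0; apply: andb_idl => /eqP->.
  by rewrite sub0set; apply/forall_inP=> x; rewrite inE.
case/andP=> tauF pFs.
have nFT : F != setT.
  have := order_path_min (@pincl_trans E) pFs.
  by rewrite all_rcons => /andP[]; rewrite /pincl properEneq => /andP[].
have ltFs W : W \in s -> F \proper W.
  move=> sW; have := order_path_min (@pincl_trans E) pFs.
  by rewrite all_rcons => /andP[_ /allP/(_ W sW)].
have nFs : F \notin s by apply/negP=> /ltFs; rewrite properxx.
have eqz G : (G \in covectors M) && (sv_le G tau && (sv_zeros G == F)) ->
    #|[set Gs in tope_complex M tau |
         (@sv_zeros E) @: Gs == [set:: F :: s] & G \in Gs]|
      = chain_count G s.
  case/and3P=> MG Gtau /eqP zG; rewrite -IHs ?zG // -!sum1_card.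
  rewrite (reindex_onto (fun Hs => G |: Hs) (fun Gs => Gs :\ G)) /=; last first.
    by move=> Gs; rewrite inE => /and3P[_ _ GGs]; rewrite setD1K.
  apply: eq_bigl => Hs; apply/andP/idP => [[]|].
    rewrite inE => /and3P[tGs /eqP zGs _] /eqP HsG.
    have zI := zeros_inj_flag tGs.
    have HsGs Y : Y \in Hs -> Y \in G |: Hs by move=> HY; rewrite in_setU1 HY orbT.
    have nGHs : G \notin Hs by rewrite -HsG setD11.
    have HsF Y : Y \in Hs -> sv_zeros Y \in s.
      move=> HY; have : sv_zeros Y \in [set:: F :: s] by rewrite -zGs imset_f ?HsGs.
      rewrite inE in_cons => /predU1P[zY|//].
      have eYG : Y = G by apply: zI; rewrite ?zG ?setU11 ?HsGs.
      by rewrite -eYG HY in nGHs.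
    move: tGs; rewrite !inE => /andP[/subsetP sGs /forall_inP totGs].
    apply/andP; split; last first.
      apply/eqP/setP=> W; apply/imsetP/idP => [[Y HY ->]|]; first by rewrite inE HsF.
      rewrite inE => sW; have : W \in [set:: F :: s] by rewrite inE in_cons sW orbT.
      rewrite -zGs => /imsetP[Y]; rewrite in_setU1 => /predU1P[->|HY] defW.
        by rewrite defW zG (negPf nFs) in sW.
      by exists Y.
    apply/andP; split.
      apply/subsetP=> Y HY; have := sGs Y (HsGs Y HY).
      rewrite !inE => /and3P[-> -> _]; rewrite /sv_lt /=.
      have ltzY := ltFs _ (HsF Y HY).
      have neYG : Y != G by apply: contraNneq nGHs => <-.
      rewrite neYG; move/forall_inP: (totGs Y (HsGs Y HY)) => /(_ G (setU11 _ _)).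
      case/orP=> // /sv_le_zeros; rewrite zG => YF.
      by move: ltzY; rewrite properE YF andbF.
    apply/forall_inP=> X HX; apply/forall_inP=> Y HY.
    by move/forall_inP: (totGs X (HsGs X HX)) => /(_ Y (HsGs Y HY)).
  rewrite inE => /andP[tHs /eqP zHs].
  have ltG Y : Y \in Hs -> sv_lt Y G.
    move: (tHs); rewrite inE => /andP[/subsetP sHs _] /sHs.
    by rewrite inE => /and3P[].
  have nGHs : G \notin Hs by apply/negP=> /ltG /andP[/eqP].
  split; last by rewrite setU1K.
  rewrite inE setU11 andbT imsetU1 zHs zG set_cons eqxx andbT.
  apply: (flagsU1 _ tHs) => [||Y /ltG/andP[_ ->]]; last 1 first.
  - by rewrite orbT.
  - exact: sv_le_refl.
  apply/subsetP=> Y; rewrite in_setU1 inE => /predU1P[->|].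
    rewrite inE MG /sv_lt Gtau andbT /= -andbA; apply/and3P; split.
    - apply: contraNneq nFT => G0; rewrite -zG -G0.
      by apply/eqP/setP=> e; rewrite !inE ffunE.
    - by apply/sv_leP=> e; rewrite ffunE.
    - by apply: contraTneq tauF => <-; rewrite /pincl zG properxx.
  case/and3P=> MY Y0 /andP[nYG YG].
  rewrite inE MY Y0 /= /sv_lt (sv_le_trans YG Gtau) andbT.
  apply: contraNneq nYG => eYt; apply/eqP; apply: (sv_le_eq YG).
  by rewrite eYt sv_le_zeros.
rewrite -(eq_bigr _ eqz) -sum1_card.
under [RHS]eq_bigr do rewrite -sum1_card.
rewrite [RHS](exchange_big_dep
  (mem [set Gs in tope_complex M tau |
          (@sv_zeros E) @: Gs == [set:: F :: s]])) /=; last first.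
  by move=> G Gs _; rewrite !inE => /and3P[-> ->].
apply: eq_bigr => Gs tGs.
have [tGsc zGs] : Gs \in tope_complex M tau /\ (@sv_zeros E) @: Gs = [set:: F :: s].
  by move: tGs; rewrite inE => /andP[? /eqP].
have [G GGs zG] : exists2 G, G \in Gs & F = sv_zeros G.
  by apply/imsetP; rewrite zGs inE mem_head.
rewrite (big_pred1 G) // => G'; rewrite inE tGsc zGs eqxx /=.
apply/andP/eqP=> [[/and3P[_ _ /eqP zG'] G'Gs]|->].
  by apply: (zeros_inj_flag tGsc) => //; rewrite zG'.
rewrite GGs -zG eqxx andbT.
move: tGsc; rewrite inE => /andP[/subsetP/(_ G GGs) + _].
by rewrite inE => /and3P[-> _ /andP[_ ->]].
Qed.

(** The number of covectors with zero set F above a covector G depends only on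
    the zero set of G, so it can be factored out of the sum over G. The last
    factor, for the interval up to E, comes from the covectors above 0. *)
Lemma sum_chain_count F s : F \in flats N -> {subset s <= flats N} ->
    path (@pincl E) F (rcons s setT) ->
  \sum_(tau in M | sv_zeros tau == F) (chain_count tau s)%:R =
  \prod_(k < (size s).+1)
    (poincare (interval N (nth set0 (F :: rcons s setT) k)
                          (nth set0 (F :: rcons s setT) k.+1))).[1] :> int.
Proof.
elim: s F => [|F1 s IHs] F NF Ns /=.
  move=> _; rewrite big_ord1 /=.
  have z0 : sv_zeros (sv0 E) = setT by apply/setP=> e; rewrite !inE ffunE.
  rewrite -z0 las_vergnas_zaslavsky ?cov0 ?z0 ?subsetT // -sum1_card natr_sum.
  apply: eq_bigl => tau; rewrite inE; congr (_ && _); apply/esym/andb_idl=> _.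
  by apply/sv_leP=> e; rewrite ffunE.
case/andP=> FF1 pF1s; rewrite big_ord_recl /=.
have NF1 : F1 \in flats N by apply: Ns; rewrite mem_head.
rewrite -IHs //; last by move=> W sW; apply: Ns; rewrite inE sW orbT.
under eq_bigr do rewrite natr_sum.
rewrite (exchange_big_dep
  (fun G => (G \in covectors M) && (sv_zeros G == F1))) /=; last first.
  by move=> tau G _ /and3P[-> _ ->].
rewrite mulr_sumr; apply: eq_bigr => G /andP[MG zG].
rewrite -{2}(eqP zG) las_vergnas_zaslavsky //; last by rewrite (eqP zG) proper_sub.
rewrite -sum1_card natr_sum mulr_suml; apply: eq_big => [tau|tau _].
  by rewrite inE MG zG /= andbT -andbA; congr (_ && _); rewrite andbC.
by rewrite mul1r.
Qed.

Lemma lbot_underlying : lbot N \in flats N.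
Proof.
apply: (big_ind (fun H => H \in flats N)); first exact: flatsT.
  exact: flatsI.
by [].
Qed.

Lemma ltop_underlying : ltop N = setT.
Proof. by apply/eqP; rewrite -subTset /ltop bigcup_sup ?flatsT. Qed.

(** If tau is maximal, composing any covector Y after it gives tau back, so the
    zero set of tau lies in that of Y, hence in every flat. *)
Lemma topesE tau : (tau \in topes M) = (tau \in covectors M) && (sv_zeros tau == lbot N).
Proof.
rewrite inE; case Mtau: (tau \in covectors M) => //=.
have sbot : lbot N \subset sv_zeros tau by apply: bigcap_inf; exact: zeros_flat.
apply/forall_inP/eqP=> [max|ztau Y MY]; last first.
  apply/negP=> /andP[/eqP neq le]; apply: neq; apply: (sv_le_eq le).
  by rewrite ztau; apply: bigcap_inf; exact: zeros_flat.
apply/eqP; rewrite eqEsubset sbot andbT; apply/bigcapsP=> F /flatP[Y MY ->].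
have := max _ (cov_comp Mtau MY); rewrite /sv_lt sv_le_comp andbT negbK => /eqP def.
by rewrite def sv_zeros_comp subsetIr.
Qed.

End Topes.

(** * Comparison of the two polynomials *)

Section Assembly.
Variables (E : finType) (M : oriented_matroid E).
Notation N := (underlying_matroid M).
Notation r := (om_rank M).
Hypothesis r_gt0 : (0 < r)%N.
Implicit Types (tau G : {ffun E -> sign}) (Gs : {set {ffun E -> sign}}).
Implicit Types (F : {set {set E}}).

Definition weight k : {poly int} := 'X ^+ k * (1 - 'X) ^+ (r - 1 - k).

Lemma mem_proper_part Z : (Z \in proper_part N) =
  [&& Z != setT, Z != lbot N & Z \in flats N].
Proof. by rewrite !in_setD1 ltop_underlying. Qed.

Lemma proper_partP Z : Z \in proper_part N ->
  [/\ Z \in flats N, lbot N \proper Z & Z \proper setT].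
Proof.
rewrite mem_proper_part => /and3P[nZT nZb NZ]; split=> //.
  by rewrite properEneq eq_sym nZb bigcap_inf.
by rewrite properEneq nZT subsetT.
Qed.

Lemma lbot_proper : lbot N \proper setT.
Proof.
rewrite properEneq subsetT andbT; apply: contraTneq r_gt0 => botT.
rewrite -leqNgt; apply/bigmax_leqP=> F; rewrite inE => /andP[/subsetP sF _].
rewrite leqn0 cards_eq0; apply/eqP/setP=> Z; rewrite inE; apply/negP=> /sF.
rewrite inE ltop_underlying -botT => /andP[NZ]; rewrite properE bigcap_inf // andbF.
by [].
Qed.

(** Adding the bottom flat still gives a chain strictly below the top. *)
Lemma card_flag_ltn F : F \in flags (@incl E) (proper_part N) -> (#|F| < r)%N.
Proof.
move=> fF; have ltF Y : Y \in F -> lbot N \proper Y.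
  by move=> FY; move: fF; rewrite inE => /andP[/subsetP/(_ Y FY)/proper_partP[]].
have nbF : lbot N \notin F by apply/negP=> /ltF; rewrite properxx.
apply: (@leq_trans #|lbot N |: F|); first by rewrite cardsU1 nbF.
apply: (@leq_bigmax_cond _ _ (fun F : {set {set E}} => #|F|)).
apply: (flagsU1 _ fF) => [Y||Y FY]; first exact: subxx.
  apply/subsetP=> Y; rewrite in_setU1 [Y \in [set _ in _ | _]]inE ltop_underlying.
  case/predU1P=> [->|/proper_partP[-> _ -> //]].
  by rewrite lbot_underlying lbot_proper.
by rewrite /incl (proper_sub (ltF _ FY)).
Qed.

Lemma zeros_flag tau Gs : tau \in topes M -> Gs \in tope_complex M tau ->
  (@sv_zeros E) @: Gs \in flags (@incl E) (proper_part N).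
Proof.
rewrite topesE => /andP[Mtau /eqP ztau].
rewrite inE => /andP[/subsetP sGs /forall_inP tot].
rewrite inE; apply/andP; split.
  apply/subsetP=> _ /imsetP[G /sGs + ->]; rewrite inE.
  case/and3P=> MG /andP[n0G le0G] /andP[nGt leGt].
  rewrite mem_proper_part zeros_flat // andbT; apply/andP; split.
    apply: contraNneq n0G => zG; apply/eqP; apply: (sv_le_eq le0G).
    by rewrite zG subsetT.
  apply: contraNneq nGt => zG; apply/eqP; apply: (sv_le_eq leGt).
  by rewrite zG ztau.
apply/forall_inP=> _ /imsetP[X GX ->]; apply/forall_inP=> _ /imsetP[Y GY ->].
move/forall_inP: (tot X GX) => /(_ Y GY) /orP[] /sv_le_zeros;
  by rewrite /incl => ->; rewrite ?orbT.
Qed.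

Lemma card_zeros_flag tau Gs : Gs \in tope_complex M tau ->
  #|(@sv_zeros E) @: Gs| = #|Gs|.
Proof. by move=> fGs; rewrite card_in_imset //; exact: (zeros_inj_flag fGs). Qed.

Lemma tope_hE tau : tau \in topes M ->
  tope_h M tau = (\sum_(Gs in tope_complex M tau) weight #|Gs|)%:F.
Proof.
move=> Ttau; pose T : {fraction {poly int}} := ('X)%:F.
have nT : 1 - T != 0.
  rewrite -tofrac1 -tofracB tofrac_eq0 -oppr_eq0 opprB.
  by rewrite -polyC1 polyXsubC_eq0.
have ltr Gs : Gs \in tope_complex M tau -> (#|Gs| < r)%N.
  move=> fGs; rewrite -(card_zeros_flag fGs); apply: card_flag_ltn.
  exact: zeros_flag fGs.
have -> : tope_h M tau =
    \sum_(k < r) (1 - T) ^+ (r - 1)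
      * (#|[set F in tope_complex M tau | #|F| == k]|%:R * (T / (1 - T)) ^+ k).
  rewrite /tope_h -mulr_sumr; congr (_ * _).
  have -> : map_poly intr (tope_f M tau) =
      \poly_(k < r) #|[set F in tope_complex M tau | #|F| == k]|%:R
      :> {poly {fraction {poly int}}}.
    apply/polyP=> k; rewrite coef_map_id0 // !coef_poly.
    by case: ifP => // _; rewrite rmorph_nat.
  exact: horner_poly.
under eq_bigr => k _ do rewrite -sum1_card natr_sum mulr_suml mulr_sumr.
rewrite (exchange_big_dep (mem (tope_complex M tau))) /=; last first.
  by move=> k Gs _; rewrite inE => /andP[].
rewrite rmorph_sum; apply: eq_bigr => Gs fGs.
rewrite (big_pred1 (Ordinal (ltr Gs fGs))) => [|k]; last by rewrite inE fGs eq_sym.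
rewrite /= mul1r /weight rmorphM !rmorphXn rmorphB rmorph1 /= -/T.
have le : (#|Gs| <= r - 1)%N by rewrite subn1 -ltnS prednK // ltr.
rewrite -{1}(subnK le) exprD expr_div_n mulrCA; congr (_ * _).
by rewrite mulfK ?expf_neq0.
Qed.

Lemma sum_flags_zeros F : F \in flags (@incl E) (proper_part N) ->
  \sum_(tau in topes M)
     #|[set Gs in tope_complex M tau | (@sv_zeros E) @: Gs == F]|%:R
    = (flag_poincare N F).[1].
Proof.
move=> fF; have sF := flag_sorted fF; set s := sort _ _ in sF.
have defF : F = [set:: s] by apply/setP=> Z; rewrite inE mem_flag_sort.
have ltF Z : Z \in s -> [/\ Z \in flats N, lbot N \proper Z & Z \proper setT].
  rewrite mem_flag_sort => FZ; apply: proper_partP.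
  by move: fF; rewrite inE => /andP[/subsetP/(_ Z FZ)].
have path_s : path (@pincl E) (lbot N) (rcons s setT).
  move: sF ltF; case: (s) => [|Z s' ps lts]; first by rewrite /= /pincl lbot_proper.
  rewrite /= in ps; rewrite rcons_path /= ps; have [_ bZ _] := lts Z (mem_head _ _).
  by rewrite /pincl bZ; case: (lts _ (mem_last _ _)).
have sz_s : size s = #|F| by exact: size_flag_sort.
rewrite /flag_poincare horner_prod -sz_s /flag_seq -/s ltop_underlying.
rewrite -sum_chain_count ?lbot_underlying //; last by move=> Z /ltF[].
apply: eq_big => tau; first exact: topesE.
by rewrite topesE => /andP[_ /eqP ztau]; rewrite -card_flags_zeros ?ztau // {1}defF.
Qed.

End Assembly.

Theorem proposition4p3 (E : finType) (M : oriented_matroid E)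
    (hr : (1 <= om_rank M)%N) :
  ((coarse_flag_poly (underlying_matroid M)).[1])%:F
    = \sum_(tau in topes M) tope_h M tau.
Proof.
rewrite (eq_bigr _ (tope_hE hr)) -rmorph_sum; congr (_%:F).
rewrite /coarse_flag_poly horner_sum.
under [RHS]eq_bigr => tau Ttau do
  rewrite (partition_big _ _ (fun Gs => zeros_flag (Gs := Gs) Ttau)).
rewrite [RHS]exchange_big /=; apply: eq_bigr => F fF.
rewrite hornerM hornerC -[in _.[1]]polyC1 horner_map /= -(sum_flags_zeros hr fF).
rewrite rmorph_sum mulr_suml; apply: eq_bigr => tau Ttau.
rewrite rmorph_nat mulr_natl -sumr_const big_set /=; apply: eq_bigr => Gs.
by case/andP=> tGs /eqP <-; rewrite (card_zeros_flag tGs).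
Qed.
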